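(* Let $\mathcal{M}=\{M^x: x\in\Lambda\}$ be a standard log-convex weight matrix and let $\mathcal{M}':=\{M^{x;l}:x\in\Lambda,\ l>0\}$, where $M^{x;l}_j:=\exp\left(\frac1l\varphi^*_{\omega_{M^x}}(lj)\right)$. (1) (Roumieu case) $\mathcal{M}\{\approx\}\mathcal{M}'$ if and only if for all $x\in\Lambda$ there exist $C>0$ and $y_1,y_2\in\Lambda$ such that $M^x_{j+k}\le C^{j+k}M^{y_1}_jM^{y_2}_k$ for all $j,k\in\mathbb{N}$. (2) (Beurling case) Provided $\Lambda=\mathbb{R}_{>0}$ (with its natural order): $\mathcal{M}(\approx)\mathcal{M}'$ if and only if for all $x_1,x_2\in\Lambda$ there exist $C>0$ and $y\in\Lambda$ such that $M^y_{j+k}\le C^{j+k}M^{x_1}_jM^{x_2}_k$ for all $j,k\in\mathbb{N}$.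
   Context: $\mathbb{N}=\{0,1,2,\dots\}$. A weight sequence is $M=(M_k)_{k\in\mathbb{N}}$ with $M_k>0$. It is normalized if $1=M_0\le M_1$, log-convex if $M_j^2\le M_{j-1}M_{j+1}$ for all $j\ge1$. $\mathcal{LC}$ is the set of normalized log-convex $M$ with $\lim_{k\to\infty}(M_k)^{1/k}=+\infty$. $(\Lambda,\le)$ is a partially ordered set which is both upward and downward directed. A weight matrix is a family $\mathcal{M}=\{M^x:x\in\Lambda\}$ of normalized, increasing weight sequences with $M^x\le M^y$ (termwise) for $x\le y$. It is standard log-convex if moreover every $M^x\in\mathcal{LC}$. Associated function: $\omega_M(t):=\sup_{p\in\mathbb{N}}\log(t^p/M_p)$ for $t>0$, $\omega_M(0):=0$ (here $M_0=1$). For a function $\omega$ on $[0,\infty)$ put $\varphi_\omega(y):=\omega(e^y)$ and $\varphi^*_\omega(x):=\sup\{xy-\varphi_\omega(y):y\ge0\}$, $x\ge0$. For sequences, $M\preceq N$ means $\sup_{p\ge1}(M_p/N_p)^{1/p}<+\infty$. For families $\mathcal{M}=\{M^x:x\in\Lambda\}$, $\mathcal{N}=\{N^y:y\in\Lambda'\}$: $\mathcal{M}\{\preceq\}\mathcal{N}$ means $\forall x\in\Lambda\ \exists y\in\Lambda':M^x\preceq N^y$; $\mathcal{M}(\preceq)\mathcal{N}$ means $\forall y\in\Lambda'\ \exists x\in\Lambda:M^x\preceq N^y$. $\mathcal{M}\{\approx\}\mathcal{N}$ means $\mathcal{M}\{\preceq\}\mathcal{N}$ and $\mathcal{N}\{\preceq\}\mathcal{M}$;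 $\mathcal{M}(\approx)\mathcal{N}$ means $\mathcal{M}(\preceq)\mathcal{N}$ and $\mathcal{N}(\preceq)\mathcal{M}$. *)

(* Defs.v *)
From HB Require Import structures.
From mathcomp Require Import all_boot all_order all_algebra.
From mathcomp Require Import all_classical all_reals all_analysis.
Set Implicit Arguments.
Unset Strict Implicit.
Unset Printing Implicit Defensive.
Import Order.TTheory GRing.Theory Num.Theory.
Import numFieldNormedType.Exports.
Local Open Scope classical_set_scope.
Local Open Scope ring_scope.

Section WeightSequences.
Variable R : realType.
Implicit Types M N : nat -> R.

Definition weight_sequence M := forall k, 0 < M k.

Definition normalized M := M 0%N = 1 /\ 1 <= M 1%N.

Definition log_convex M :=
  forall j, (1 <= j)%N -> M j ^+ 2 <= M j.-1 * M j.+1.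

(* The term k = 0 of the root sequence is irrelevant for the limit. *)
Definition LC M :=
  [/\ weight_sequence M, normalized M, log_convex M &
      (M k `^ (k%:R^-1)) @[k --> \oo] --> +oo].

(* [sup] is real-valued.  For t > 0 the supremum is finite as soon as
   (M k)^(1/k) tends to +oo, in particular for every M in LC. *)
Definition omega M (t : R) : R :=
  if t == 0 then 0 else sup [set ln (t ^+ p / M p) | p in [set: nat]].

Definition phi (w : R -> R) (y : R) : R := w (expR y).

(* The Young conjugate.  If w = omega M with M in LC, then log t = o(w t) as
   t tends to +oo, hence the real-valued [sup] is a finite supremum. *)
Definition phi_star (w : R -> R) (x : R) : R :=
  sup [set x * y - phi w y | y in [set y : R | 0 <= y]].

Definition seq_preceq M N : Prop :=
  (ereal_sup [set ((M p / N p) `^ (p%:R^-1))%:E | p in [set p | (1 <= p)%N]]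
     < +oo)%E.

End WeightSequences.

Section WeightMatrices.
Variable R : realType.

Definition upward_directed d (L : porderType d) :=
  forall x y : L, exists z : L, (x <= z)%O /\ (y <= z)%O.

Definition downward_directed d (L : porderType d) :=
  forall x y : L, exists z : L, (z <= x)%O /\ (z <= y)%O.

Definition weight_matrix d (L : porderType d) (M : L -> nat -> R) :=
  (forall x, [/\ weight_sequence (M x), normalized (M x) &
                 {homo M x : j k / (j <= k)%N >-> j <= k}]) /\
  (forall x y, (x <= y)%O -> forall k, M x k <= M y k).

Definition standard_log_convex d (L : porderType d) (M : L -> nat -> R) :=
  weight_matrix M /\ forall x, LC (M x).

Definition roumieu_preceq (I J : Type)
    (M : I -> nat -> R) (N : J -> nat -> R) :=
  forall x, exists y, seq_preceq (M x) (N y).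

Definition beurling_preceq (I J : Type)
    (M : I -> nat -> R) (N : J -> nat -> R) :=
  forall y, exists x, seq_preceq (M x) (N y).

Definition roumieu_approx (I J : Type)
    (M : I -> nat -> R) (N : J -> nat -> R) :=
  roumieu_preceq M N /\ roumieu_preceq N M.

Definition beurling_approx (I J : Type)
    (M : I -> nat -> R) (N : J -> nat -> R) :=
  beurling_preceq M N /\ beurling_preceq N M.

Definition assoc_matrix (I : Type) (M : I -> nat -> R)
    (xl : I * {posnum R}) (j : nat) : R :=
  let l : R := xl.2%:num in
  expR (l^-1 * phi_star (omega (M xl.1)) (l * j%:R)).

End WeightMatrices.

(* Main.v *)
(** For M in LC put m k = ln (M k), a convex sequence with m 0 = 0.  The Young
    conjugate F = phi_star (omega M) is the piecewise linear interpolation of m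
    at the integers; in particular it is convex with F 0 = 0, so F (l t) / l is
    nondecreasing in l.  Taking l = 1 gives one half of each equivalence for
    free.  The mixed growth condition
      m_x (j + k) <= c (j + k) + m_y j + m_y k
    amounts to F_x t <= c t + 2 F_y (t / 2) for all real t >= 0: one direction
    is midpoint convexity, the other holds because at a half-integer F_y is the
    average of two consecutive values of m_y.  Iterating the halving reaches
    all l <= 2 ^ n (Roumieu) or l >= 2 ^- n (Beurling). *)
Require Import Defs.
From mathcomp Require Import all_boot all_order all_algebra.
From mathcomp Require Import all_classical all_reals all_analysis.
From mathcomp Require Import ring lra.
Import Order.TTheory GRing.Theory Num.Theory.
Local Open Scope ring_scope.

(** * Convex sequences and logarithms of sequences in [LC] *)

Lemma convex_seq_above_chord (R : realDomainType) (m : nat -> R) :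
  (forall j, m j.+1 *+ 2 <= m j + m j.+2) ->
  forall k p, m k + (p%:R - k%:R) * (m k.+1 - m k) <= m p.
Proof.
move=> mcvx.
(* Convexity makes the increments nondecreasing; adding them up to the right of [k] ([up]) and to
   the left ([down]) keeps [m] above the line through its values at [k] and [k.+1]. *)
have incr : {homo (fun j => m j.+1 - m j) : j k / (j <= k)%N >-> j <= k}.
  apply: homo_leq => [x|y x z|j]; [exact: lexx|exact: le_trans|].
  by have := mcvx j; lra.
have up k n : m k + n%:R * (m k.+1 - m k) <= m (k + n)%N.
  elim: n => [|n IH]; first by rewrite addn0 mul0r addr0.
  have := incr k (k + n)%N (leq_addr _ _).
  by rewrite addnS -[n.+1%:R]natr1; lra.
have down k n : m (k + n)%N - n%:R * (m (k + n).+1 - m (k + n)%N) <= m k.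
  elim: n => [|n IH]; first by rewrite addn0 mul0r subr0.
  have := incr (k + n)%N (k + n).+1 (leqnSn _).
  have := ler_wpM2l (ler0n R n) (incr (k + n)%N (k + n).+1 (leqnSn _)).
  by rewrite addnS -[n.+1%:R]natr1; lra.
move=> k p; have [/subnKC <-|/ltnW/subnKC <-] := leqP k p.
  by have := up k (p - k)%N; rewrite natrD; lra.
by have := down p (k - p)%N; rewrite natrD; lra.
Qed.

Lemma LC_gt0 (R : realType) (M : nat -> R) (k : nat) : LC M -> 0 < M k.
Proof. by case. Qed.

Lemma ln_LC0 (R : realType) (M : nat -> R) : LC M -> ln (M 0%N) = 0.
Proof. by case=> _ [-> _] _ _; exact: ln1. Qed.

Lemma ln_LC_convex (R : realType) (M : nat -> R) (j : nat) :
  LC M -> ln (M j.+1) *+ 2 <= ln (M j) + ln (M j.+2).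
Proof.
move=> [M0 _ Mcvx _]; rewrite -lnXn // -lnM ?posrE //.
by rewrite ler_ln ?posrE ?exprn_gt0 ?mulr_gt0 //; exact: Mcvx j.+1 isT.
Qed.

(** * The function [phi (omega M)] as a conjugate of [ln M] *)

Lemma phi_omegaE (R : realType) (M : nat -> R) (y : R) : weight_sequence M ->
  phi (omega M) y = sup [set p%:R * y - ln (M p) | p in [set: nat]]%classic.
Proof.
move=> M0; rewrite /phi /omega gt_eqF ?expR_gt0 //; congr sup.
congr image; apply/funext => p.
rewrite ln_div ?posrE ?exprn_gt0 ?expR_gt0 // lnXn ?expR_gt0 // expRK.
by rewrite mulr_natl.
Qed.

(** Once the root [(M p) ^ (1/p)] exceeds [expR y], the term of index [p] is at most 0; the finitely
    many earlier terms are bounded by the sum of their absolute values. *)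
Lemma phi_omega_has_ubound (R : realType) (M : nat -> R) (y : R) : LC M ->
  has_ubound [set p%:R * y - ln (M p) | p in [set: nat]]%classic.
Proof.
move=> [M0 _ _ /cvgryPge/(_ (expR y)) [N _ ltN]].
exists (\sum_(i < N.+1) `|i%:R * y - ln (M i)|) => _ [p _ <-].
have [pN|Np] := ltnP p N.+1.
  rewrite (bigD1 (Ordinal pN)) //=; apply: ler_wpDr; last exact: ler_norm.
  exact: sumr_ge0.
apply: (@le_trans _ _ 0); last exact: sumr_ge0.
have p0 : (0 : R) < p%:R by rewrite ltr0n (leq_ltn_trans _ Np).
have := ltN p (ltnW Np).
rewrite -ler_ln ?posrE ?expR_gt0 ?powR_gt0 // expRK ln_powR.
by rewrite -ler_pdivrMl ?invr_gt0 // invrK subr_le0.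
Qed.

Lemma phi_omega_ge (R : realType) (M : nat -> R) (y : R) (p : nat) : LC M ->
  p%:R * y - ln (M p) <= phi (omega M) y.
Proof.
move=> hM; rewrite phi_omegaE; last by case: hM.
by apply: ub_le_sup; [exact: phi_omega_has_ubound | exists p].
Qed.

(** The line of this slope through the point at [k] supports the convex sequence [ln M], so the
    index [p = k] maximizes. *)
Lemma phi_omega_slope (R : realType) (M : nat -> R) (k : nat) : LC M ->
  phi (omega M) (ln (M k.+1) - ln (M k)) <=
  k%:R * (ln (M k.+1) - ln (M k)) - ln (M k).
Proof.
move=> hM; rewrite phi_omegaE; last by case: hM.
apply: ge_sup => [|_ [p _ <-]].
  by exists (0%:R * (ln (M k.+1) - ln (M k)) - ln (M 0%N)), 0%N.
have := @convex_seq_above_chord _ (fun j => ln (M j))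
  (fun j => ln_LC_convex _ _ j hM) k p.
by lra.
Qed.

(** This makes the slopes of [ln M] nonnegative, hence admissible in the supremum over [0 <= y] that
    defines [phi_star]. *)
Lemma ln_LC_nondecreasing (R : realType) (M : nat -> R) (k : nat) : LC M ->
  ln (M k) <= ln (M k.+1).
Proof.
move=> hM; elim: k => [|k IH].
  by rewrite ln_LC0 // ln_ge0 //; case: hM => _ [].
by have := ln_LC_convex _ _ k hM; lra.
Qed.

(** * The Young conjugate as a piecewise linear interpolation *)

Lemma phi_star_interp_ub (R : realType) (M : nat -> R) (k : nat) (s y : R) :
  LC M -> 0 <= s <= 1 ->
  (k%:R + s) * y - phi (omega M) y <=
  (1 - s) * ln (M k) + s * ln (M k.+1).
Proof.
move=> hM /andP[s0 s1].
have h0 : 0 <= phi (omega M) y - (k%:R * y - ln (M k)).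
  by rewrite subr_ge0 phi_omega_ge.
have h1 : 0 <= phi (omega M) y - (k.+1%:R * y - ln (M k.+1)).
  by rewrite subr_ge0 phi_omega_ge.
have s1' : 0 <= 1 - s by rewrite subr_ge0.
(* Average the Young inequalities at [k] and [k.+1] with weights [1 - s] and [s]. *)
have := addr_ge0 (mulr_ge0 s1' h0) (mulr_ge0 s0 h1).
by rewrite -natr1; lra.
Qed.

(* The maximizing slope is y = ln (M k.+1) - ln (M k), where the supremum
   defining phi (omega M) y is attained at both k and k.+1. *)
Lemma phi_starE (R : realType) (M : nat -> R) (k : nat) (s : R) :
  LC M -> 0 <= s <= 1 ->
  phi_star (omega M) (k%:R + s) = (1 - s) * ln (M k) + s * ln (M k.+1).
Proof.
move=> hM s01; apply/eqP; rewrite eq_le; apply/andP; split.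
  apply: ge_sup => [|_ [y _ <-]]; last exact: phi_star_interp_ub.
  by exists ((k%:R + s) * 0 - phi (omega M) 0), 0; rewrite /=.
set y := ln (M k.+1) - ln (M k).
apply: (@le_trans _ _ ((k%:R + s) * y - phi (omega M) y)).
  by have := phi_omega_slope _ _ k hM; rewrite -/y /y; lra.
apply: ub_le_sup; last first.
  by exists y => //=; rewrite /y subr_ge0 ln_LC_nondecreasing.
exists ((1 - s) * ln (M k) + s * ln (M k.+1)) => _ [z _ <-].
exact: phi_star_interp_ub.
Qed.

Lemma phi_star_nat (R : realType) (M : nat -> R) (k : nat) : LC M ->
  phi_star (omega M) k%:R = ln (M k).
Proof.
move=> hM; have := @phi_starE _ _ k 0 hM; rewrite addr0 => ->.
  by ring.
by rewrite lexx ler01.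
Qed.

Lemma phi_star0 (R : realType) (M : nat -> R) : LC M ->
  phi_star (omega M) 0 = 0.
Proof. by move=> hM; rewrite (phi_star_nat _ _ 0 hM) ln_LC0. Qed.

Lemma natr_frac (R : realType) (t : R) : 0 <= t ->
  exists k s, 0 <= s <= 1 /\ t = k%:R + s :> R.
Proof.
move=> /truncn_itv /andP[k0 k1].
exists (Num.truncn t), (t - (Num.truncn t)%:R).
by move: k0 k1; rewrite -natr1 => k0 k1; split; [apply/andP; split; lra|ring].
Qed.

(** A real [sup] dominates its set only if the set is bounded; here the interpolation formula
    supplies the bound. *)
Lemma phi_star_ge (R : realType) (M : nat -> R) (t y : R) :
  LC M -> 0 <= t -> 0 <= y ->
  t * y - phi (omega M) y <= phi_star (omega M) t.
Proof.
move=> hM /natr_frac [k [s [s01 ->]]] y0; rewrite phi_starE //.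
exact: phi_star_interp_ub.
Qed.

(** A supremum of functions affine in the argument is convex. *)
Lemma phi_star_convex (R : realType) (M : nat -> R) (s a b : R) :
  LC M -> 0 <= s <= 1 -> 0 <= a -> 0 <= b ->
  phi_star (omega M) ((1 - s) * a + s * b) <=
  (1 - s) * phi_star (omega M) a + s * phi_star (omega M) b.
Proof.
move=> hM /andP[s0 s1] a0 b0; apply: ge_sup => [|_ [y y0 <-]].
  by exists (((1 - s) * a + s * b) * 0 - phi (omega M) 0), 0; rewrite /=.
have s1' : 0 <= 1 - s by rewrite subr_ge0.
have ha := ler_wpM2l s1' (phi_star_ge _ _ _ _ hM a0 y0).
have hb := ler_wpM2l s0 (phi_star_ge _ _ _ _ hM b0 y0).
by lra.
Qed.

(** Convexity with weight [a / b] on the point [b * t] and the rest on 0, where the conjugate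
    vanishes. *)
Lemma phi_star_ratio_mono (R : realType) (M : nat -> R) (a b t : R) :
  LC M -> 0 < a -> a <= b -> 0 <= t ->
  a^-1 * phi_star (omega M) (a * t) <= b^-1 * phi_star (omega M) (b * t).
Proof.
move=> hM a0 ab t0; have b0 : 0 < b by exact: lt_le_trans ab.
have s01 : 0 <= a / b <= 1.
  by rewrite (divr_ge0 (ltW a0) (ltW b0)) ler_pdivrMr // mul1r.
have := phi_star_convex _ _ _ 0 (b * t) hM s01 (lexx _) (mulr_ge0 (ltW b0) t0).
rewrite phi_star0 // !mulr0 !add0r mulrA divfK ?gt_eqF // => h.
by rewrite ler_pdivrMl // mulrA.
Qed.

(** * Mixed growth and halving of the argument *)

Lemma phi_star_halving (R : realType) (M N : nat -> R) (c t : R) :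
  LC M -> LC N -> 0 <= t ->
  (forall j k, ln (M (j + k)%N) <= c * (j + k)%:R + ln (N j) + ln (N k)) ->
  phi_star (omega M) t <= c * t + 2 * phi_star (omega N) (t / 2).
Proof.
move=> hM hN /natr_frac [i [s [/andP[s0 s1] ->]]] MN.
have s1' : 0 <= 1 - s by rewrite subr_ge0.
rewrite phi_starE ?s0 //.
(* In both parities [t / 2] lies between [k] and [k.+1]. The growth bounds at the two integers
   around [t], averaged with weights [1 - s] and [s], give twice the interpolation of [ln N] at
   [t / 2]. *)
have [k e] : exists k, i = (k + k)%N \/ i = (k + k.+1)%N.
  exists i./2; have := odd_double_half i; rewrite -addnn.
  by case: (odd i) => /= e; [right; rewrite addnS|left].
case: e => ->.
- have -> : ((k + k)%:R + s) / 2 = k%:R + s / 2 by rewrite natrD; field.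
  rewrite phi_starE //; last by apply/andP; split; lra.
  have := ler_wpM2l s1' (MN k k).
  have := ler_wpM2l s0 (MN k k.+1).
  by rewrite addnS -natr1; lra.
- have -> : ((k + k.+1)%:R + s) / 2 = k%:R + (1 + s) / 2.
    by rewrite addnS -natr1 natrD; field.
  rewrite phi_starE //; last by apply/andP; split; lra.
  have := ler_wpM2l s1' (MN k k.+1).
  have := ler_wpM2l s0 (MN k.+1 k.+1).
  by rewrite addSn -natr1; lra.
Qed.

Lemma phi_star_midpoint (R : realType) (M : nat -> R) (j k : nat) : LC M ->
  2 * phi_star (omega M) ((j + k)%:R / 2) <= ln (M j) + ln (M k).
Proof.
move=> hM; have h01 : 0 <= (2^-1 : R) <= 1 by apply/andP; split; lra.
have := phi_star_convex _ _ _ j%:R k%:R hM h01 (ler0n _ _) (ler0n _ _).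
rewrite !phi_star_nat //.
have -> : (1 - 2^-1) * j%:R + 2^-1 * k%:R = (j + k)%:R / 2 :> R.
  by rewrite natrD; field.
by lra.
Qed.

(** Doubling both indices puts the midpoint at the integer [j + k]. *)
Lemma LC_ln_midpoint (R : realType) (M : nat -> R) (j k : nat) : LC M ->
  ln (M (j + k)%N) <= 2^-1 * ln (M j.*2) + 2^-1 * ln (M k.*2).
Proof.
move=> hM; have := phi_star_midpoint _ _ j.*2 k.*2 hM.
rewrite -doubleD -muln2 natrM mulfK ?pnatr_eq0 // phi_star_nat //.
by lra.
Qed.

(** * Logarithmic form of the relations *)

Lemma seq_preceqP (R : realType) (M N : nat -> R) :
  weight_sequence M -> weight_sequence N ->
  seq_preceq M N <->
  exists c, forall p, (1 <= p)%N -> ln (M p) <= c * p%:R + ln (N p).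
Proof.
move=> M0 N0.
have key p c : (1 <= p)%N ->
    ((M p / N p) `^ p%:R^-1 <= expR c) = (ln (M p) <= c * p%:R + ln (N p)).
  move=> p1; rewrite -[LHS]ler_ln ?posrE ?powR_gt0 ?divr_gt0 ?expR_gt0 //.
  rewrite expRK ln_powR ln_div ?posrE // mulrC ler_pdivrMr ?ltr0n //.
  by rewrite lerBlDr.
split=> [h|[c h]].
  have [C hC] : exists C : R,
      (ereal_sup [set ((M p / N p) `^ (p%:R^-1))%:E | p in [set p | (1 <= p)%N]]
        <= C%:E)%E.
    move: h; rewrite /seq_preceq.
    case: ereal_sup => [r _|//|_]; first by exists r.
    by exists 0; exact: leNye.
  (* The maximum with 1 makes the constant positive, so that [expR] undoes [ln]. *)
  exists (ln (Num.max C 1)) => p p1; rewrite -key // lnK; last first.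
    by rewrite posrE lt_max ltr01 orbT.
  rewrite le_max -lee_fin (le_trans _ hC) //.
  by apply: ereal_sup_ubound; exists p.
apply: (@le_lt_trans _ _ (expR c)%:E); last exact: ltry.
by apply: ge_ereal_sup => _ [p p1 <-]; rewrite lee_fin key // h.
Qed.

Lemma expr_bound_lnE (R : realType) (x a b C : R) (n : nat) :
  0 < x -> 0 < a -> 0 < b -> 0 < C ->
  (x <= C ^+ n * a * b) = (ln x <= ln C * n%:R + ln a + ln b).
Proof.
move=> x0 a0 b0 C0.
rewrite -[LHS]ler_ln ?posrE ?mulr_gt0 ?exprn_gt0 //.
by rewrite !lnM ?posrE ?mulr_gt0 ?exprn_gt0 // lnXn // mulr_natr.
Qed.

(** Inserting the second bound at [t / a] multiplies the scalings, while the linear errors only add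
    up; this makes halving iterable. *)
Lemma dilation_comp (R : realType) (F G H : R -> R) (a b c c' : R) :
  0 < a -> 0 < b ->
  (forall t, 0 <= t -> F t <= c * t + a * G (t / a)) ->
  (forall t, 0 <= t -> G t <= c' * t + b * H (t / b)) ->
  forall t, 0 <= t -> F t <= (c + c') * t + (a * b) * H (t / (a * b)).
Proof.
move=> a0 b0 FG GH t t0; apply: (le_trans (FG _ t0)).
have := ler_wpM2l (ltW a0) (GH (t / a) (divr_ge0 t0 (ltW a0))).
have e : a * (c' * (t / a)) = c' * t by field; rewrite gt_eqF.
by rewrite invfM [t * (_ * _)]mulrA; lra.
Qed.

Lemma le_exp2 (R : realType) (l : R) : exists n, l <= 2 ^+ n.
Proof.
exists (Num.truncn l).+1; apply: (le_trans (ltW (truncnS_gt l))).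
by rewrite -natrX ler_nat ltnW // ltn_expl.
Qed.

Lemma weight_matrix_ln_le (R : realType) (d : Order.disp_t) (L : porderType d)
    (M : L -> nat -> R) (x y : L) (k : nat) :
  standard_log_convex M -> (x <= y)%O -> ln (M x k) <= ln (M y k).
Proof.
move=> [[_ mono] hM] xy; rewrite ler_ln ?posrE ?LC_gt0 //.
exact: mono.
Qed.

(** * The associated matrix and the inclusions given by [l = 1] *)

Lemma ln_assoc_matrix (R : realType) (I : Type) (M : I -> nat -> R) (x : I)
    (l : {posnum R}) (j : nat) :
  ln (assoc_matrix M (x, l) j) =
  l%:num^-1 * phi_star (omega (M x)) (l%:num * j%:R).
Proof. by rewrite /assoc_matrix /= expRK. Qed.

Lemma assoc_matrix_gt0 (R : realType) (I : Type) (M : I -> nat -> R)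
    (xl : I * {posnum R}) : weight_sequence (assoc_matrix M xl).
Proof. by move=> j; exact: expR_gt0. Qed.

Lemma assoc_matrix1 (R : realType) (I : Type) (M : I -> nat -> R) (x : I) :
  LC (M x) -> assoc_matrix M (x, 1%:pos) = M x.
Proof.
move=> hM; apply/funext => j; apply: ln_inj; rewrite ?posrE.
- exact: assoc_matrix_gt0.
- exact: LC_gt0.
- by rewrite ln_assoc_matrix /= invr1 !mul1r phi_star_nat.
Qed.

Lemma seq_preceq_refl (R : realType) (M : nat -> R) :
  weight_sequence M -> seq_preceq M M.
Proof.
by move=> M0; apply/seq_preceqP => //; exists 0 => p _; rewrite mul0r add0r.
Qed.

Lemma roumieu_preceq_assoc (R : realType) (I : Type) (M : I -> nat -> R) :
  (forall x, LC (M x)) -> roumieu_preceq M (assoc_matrix M).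
Proof.
move=> hM x; exists (x, 1%:pos); rewrite assoc_matrix1 //.
by apply: seq_preceq_refl => k; exact: LC_gt0.
Qed.

Lemma beurling_assoc_preceq (R : realType) (I : Type) (M : I -> nat -> R) :
  (forall x, LC (M x)) -> beurling_preceq (assoc_matrix M) M.
Proof.
move=> hM x; exists (x, 1%:pos); rewrite assoc_matrix1 //.
by apply: seq_preceq_refl => k; exact: LC_gt0.
Qed.

(** * The Roumieu case *)

Lemma roumieu_assoc_preceq_iff (R : realType) (d : Order.disp_t)
    (L : porderType d) (M : L -> nat -> R) :
  upward_directed L -> standard_log_convex M ->
  roumieu_preceq (assoc_matrix M) M <->
  (forall x : L, exists (C : R) (y1 y2 : L), 0 < C /\
     forall j k : nat, M x (j + k)%N <= C ^+ (j + k) * M y1 j * M y2 k).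
Proof.
move=> up sM; have hM := sM.2.
have M0 x k : 0 < M x k by exact: LC_gt0.
split=> [MM x|MM].
  (* For [l = 2] the logarithm of the associated sequence at [i] is half of [ln (M x i.*2)], the
     quantity in [LC_ln_midpoint]. *)
  have [y /seq_preceqP [||c hc]] := MM (x, 2%:pos) => //.
    exact: assoc_matrix_gt0.
  exists (expR c), y, y; split=> [|j k]; first exact: expR_gt0.
  rewrite expr_bound_lnE ?expR_gt0 // expRK.
  have half i : 2^-1 * ln (M x i.*2) <= c * i%:R + ln (M y i).
    (* The relation concerns only indices from 1 on; at 0 both logarithms vanish. *)
    case: i => [|i]; first by rewrite !ln_LC0 // !mulr0 addr0.
    have := hc i.+1 isT.
    by rewrite ln_assoc_matrix /= -natrM mul2n phi_star_nat.
  have := LC_ln_midpoint _ _ j k (hM x).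
  by have := half j; have := half k; rewrite natrD; lra.
have dil n x : exists c y, forall t, 0 <= t ->
      phi_star (omega (M x)) t <=
      c * t + 2 ^+ n * phi_star (omega (M y)) (t / 2 ^+ n).
  elim: n x => [|n IH] x.
    by exists 0, x => t _; rewrite mul0r add0r expr0 mul1r divr1.
  have [C [y1 [y2 [C0 hC]]]] := MM x.
  (* Halving needs one sequence on the right, so both indices are replaced by a common upper
     bound. *)
  have [y [y1y y2y]] := up y1 y2.
  have [c [z hz]] := IH y.
  exists (ln C + c), z; rewrite exprS.
  apply: dilation_comp hz => // t t0; apply: phi_star_halving => // j k.
  have := hC j k; rewrite expr_bound_lnE // => /le_trans; apply.
  by rewrite !lerD ?weight_matrix_ln_le.
move=> [x l].
have [n ln2] := le_exp2 _ l%:num.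
have [c [y hy]] := dil n x.
exists y; apply/seq_preceqP => //; first exact: assoc_matrix_gt0.
exists c => p _; rewrite ln_assoc_matrix.
(* Raise [l] to [2 ^+ n], then apply [hy] at [t = 2 ^+ n * p], which brings the argument back to the
   integer [p]. *)
apply: (le_trans (phi_star_ratio_mono _ _ _ _ _ (hM x) _ ln2 (ler0n _ p))) => //.
have p2 : (0 : R) < 2 ^+ n by exact: exprn_gt0.
rewrite ler_pdivrMl //; apply: (le_trans (hy _ _)).
  by rewrite mulr_ge0 // ltW.
rewrite mulrAC divff ?gt_eqF // mul1r phi_star_nat //.
by rewrite mulrCA mulrDr.
Qed.

(** * The Beurling case *)

Lemma beurling_preceq_assoc_iff (R : realType) (M : {posnum R} -> nat -> R) :
  standard_log_convex M ->
  beurling_preceq M (assoc_matrix M) <->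
  (forall x1 x2 : {posnum R}, exists (C : R) (y : {posnum R}), 0 < C /\
     forall j k : nat, M y (j + k)%N <= C ^+ (j + k) * M x1 j * M x2 k).
Proof.
move=> sM; have hM := sM.2.
have M0 x k : 0 < M x k by exact: LC_gt0.
split=> [MM x1 x2|MM].
  have [x [xx1 xx2]] : exists x, (x <= x1)%O /\ (x <= x2)%O.
    by have /orP[h|h] := le_total x1 x2; [exists x1|exists x2].
  (* For [l = 1 / 2] the logarithm at [j + k] is twice the conjugate at [(j + k) / 2], which
     midpoint convexity bounds. *)
  have [y /seq_preceqP [||c hc]] := MM (x, (2^-1)%:pos) => //.
    exact: assoc_matrix_gt0.
  exists (expR c), y; split=> [|j k]; first exact: expR_gt0.
  rewrite expr_bound_lnE ?expR_gt0 // expRK.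
  apply: (@le_trans _ _ (c * (j + k)%:R + ln (M x j) + ln (M x k))).
    have [/eqP|jk] := posnP (j + k)%N.
      rewrite addn_eq0 => /andP[/eqP -> /eqP ->].
      by rewrite addn0 !ln_LC0 // mulr0 !addr0.
    have := hc _ jk.
    rewrite ln_assoc_matrix /= invrK [2^-1 * _]mulrC => /le_trans; apply.
    by rewrite -addrA lerD2l phi_star_midpoint.
  by rewrite !lerD ?weight_matrix_ln_le.
have dil n x : exists c y, forall t, 0 <= t ->
      phi_star (omega (M y)) t <=
      c * t + 2 ^+ n * phi_star (omega (M x)) (t / 2 ^+ n).
  elim: n x => [|n IH] x.
    by exists 0, x => t _; rewrite mul0r add0r expr0 mul1r divr1.
  have [C [y [C0 hC]]] := MM x x.
  have [c [z hz]] := IH y.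
  (* The new index now appears on the smaller side, so the induction hypothesis is applied first and
     the halving from [y] to [x] last. *)
  exists (c + ln C), z; rewrite exprSr.
  apply: dilation_comp hz _ => // t t0; apply: phi_star_halving => // j k.
  by have := hC j k; rewrite expr_bound_lnE.
move=> [x l].
have [n ln2] := le_exp2 _ l%:num^-1.
have [c [y hy]] := dil n x.
exists y; apply/seq_preceqP => //; first exact: assoc_matrix_gt0.
have p2 : (0 : R) < 2 ^+ n by exact: exprn_gt0.
exists c => p _; rewrite ln_assoc_matrix -phi_star_nat //.
apply: (le_trans (hy _ (ler0n _ p))); rewrite lerD2l mulrC.
(* As [2 ^- n <= l], the bound with [2 ^+ n] from [hy] is the associated sequence at parameter
   [2 ^- n], below the one at [l]. *)
have := @phi_star_ratio_mono _ (M x) (2 ^+ n)^-1 l%:num p%:R (hM x).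
rewrite invrK mulrC [X in phi_star _ X]mulrC => -> //.
by rewrite -[leRHS]invrK lef_pV2 ?posrE ?invr_gt0.
Qed.

Theorem theorem3p4 (R : realType) :
  (forall (d : Order.disp_t) (L : porderType d) (M : L -> nat -> R),
     upward_directed L -> downward_directed L -> standard_log_convex M ->
     (roumieu_approx M (assoc_matrix M) <->
      (forall x : L, exists (C : R) (y1 y2 : L), 0 < C /\
         forall j k : nat,
           M x (j + k)%N <= C ^+ (j + k) * M y1 j * M y2 k)))
  /\
  (forall M : {posnum R} -> nat -> R,
     standard_log_convex M ->
     (beurling_approx M (assoc_matrix M) <->
      (forall x1 x2 : {posnum R}, exists (C : R) (y : {posnum R}), 0 < C /\
         forall j k : nat,
           M y (j + k)%N <= C ^+ (j + k) * M x1 j * M x2 k))).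
Proof.
split=> [d L M up _ sM|M sM].
  rewrite -roumieu_assoc_preceq_iff //; split=> [[]//|MM].
  by split=> //; apply: roumieu_preceq_assoc; case: sM.
rewrite -beurling_preceq_assoc_iff //; split=> [[]//|MM].
by split=> //; apply: beurling_assoc_preceq; case: sM.
Qed.
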